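(* Let $f\colon\mathbb{C}\to\mathbb{C}$, $f(z)=e^z$, and for $z_0\in\mathbb{C}$ define its orbit by $z_n = e^{z_{n-1}}$ for $n\geq 1$. Then each of the following sets is dense in $\mathbb{C}$: 1. the set of $z_0$ whose orbit satisfies $z_n\to\infty$ (i.e. $|z_n|\to\infty$) as $n\to\infty$; 2. the set of $z_0$ whose orbit $\{z_n : n\ge 0\}$ is a dense subset of $\mathbb{C}$; 3. the set of periodic points, i.e. those $z_0$ for which there is $k>0$ with $z_{n+k}=z_n$ for all $n\geq 0$. *)

(* Defs.v *)
From Stdlib Require Import Reals.
Open Scope R_scope.

(* z = (Re z, Im z) *)
Definition C : Type := (R * R)%type.

Definition Cmod (z : C) : R := sqrt (fst z * fst z + snd z * snd z).
Definition Cdist (z w : C) : R := Cmod (fst z - fst w, snd z - snd w).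

Definition Cexp (z : C) : R * R := (exp (fst z) * cos (snd z), exp (fst z) * sin (snd z)).

Definition orbit (z0 : C) (n : nat) : C := Nat.iter n Cexp z0.

Definition dense_in_C (S : C -> Prop) : Prop :=
  forall (w : C) (eps : R), 0 < eps -> exists z, S z /\ Cdist z w < eps.

Definition escapes (z0 : C) : Prop :=
  forall M : R, exists N : nat, forall n : nat, (N <= n)%nat -> M < Cmod (orbit z0 n).

Definition dense_orbit (z0 : C) : Prop :=
  dense_in_C (fun w => exists n : nat, w = orbit z0 n).

Definition periodic_point (z0 : C) : Prop :=
  exists k : nat, (0 < k)%nat /\ forall n : nat, orbit z0 (n + k) = orbit z0 n.

(* Main.v *)
From Stdlib Require Import Reals Lra Lia Psatz Classical ClassicalEpsilon Cantor.
From Coquelicot Require Import Coquelicot.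
Require Import Defs.

(** On [C \ R] the map [exp] expands the hyperbolic metric [|dz| / |Im z|] by the factor
    [|y / sin y|] at height [y]. Heights cannot tend to [0] along an orbit that avoids [R] (the
    real part would tend to infinity and the height would then be multiplied by a factor larger
    than [1]), so the hyperbolic discs contained in the forward images of a given disc grow until
    they meet a line [Im = k PI], which is mapped into [R]. Hence every disc contains a preimage
    of a real number. Along the real axis small discs grow without bound, so pulling back by
    suitable branches of the logarithm yields, for every disc [D] and every small disc [B] away
    from [0], a branch of some [(exp^n)^-1] that maps [B] into [D] and is 1/2-Lipschitz. Applied
    to [B] around [1], to an infinite chain of discs with dense centres, and to [B = D], this
    gives respectively escaping points, dense orbits and periodic points in every disc. *)

(** * Elementary inequalities for [exp] and [sin] *)

Lemma le_of_derive_nonneg (f f' : R -> R) (a b : R) :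
  a <= b ->
  (forall t, a <= t <= b -> is_derive f t (f' t)) ->
  (forall t, a <= t <= b -> 0 <= f' t) ->
  f a <= f b.
Proof.
  intros Hab Hd Hp.
  destruct (Rle_lt_or_eq_dec _ _ Hab) as [Hlt | ->]; [| lra].
  destruct (MVT_cor2 f f' a b Hlt) as [c [Hc Hc']].
  - intros c Hc. apply is_derive_Reals, Hd, Hc.
  - assert (0 <= f' c) by (apply Hp; lra). nra.
Qed.

(** In the form [sinh^2 t >= t^2], this bounds the horizontal part of [|e^z - e^w|^2] from below. *)
Lemma sqr_sinh_ge (t : R) : 4 * (t * t) <= (exp t - exp (- t)) * (exp t - exp (- t)).
Proof.
  assert (Hpos : forall s, 0 <= s -> 2 * s <= exp s - exp (- s)).
  { intros s Hs.
    enough ((exp 0 - exp (- 0) - 2 * 0) <= (exp s - exp (- s) - 2 * s)) as H.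
    { rewrite Ropp_0, exp_0 in H. lra. }
    apply (le_of_derive_nonneg (fun x => exp x - exp (- x) - 2 * x)
             (fun x => exp x + exp (- x) - 2)); trivial.
    - intros x _. auto_derive; trivial. ring.
    - intros x _.
      assert (exp x * exp (- x) = 1) by (rewrite <- exp_plus, Rplus_opp_r; apply exp_0).
      pose proof (exp_pos x). pose proof (exp_pos (- x)).
      pose proof (Rle_0_sqr (exp x - exp (- x))). unfold Rsqr in *. nra. }
  destruct (Rle_dec 0 t) as [Ht | Ht].
  - specialize (Hpos t Ht). nra.
  - specialize (Hpos (- t)). rewrite Ropp_involutive in Hpos. nra.
Qed.

Lemma sin_sub_mul_cos_nonneg (t : R) : 0 <= t <= PI -> 0 <= sin t - t * cos t.
Proof.
  intros Ht.
  enough (sin 0 - 0 * cos 0 <= sin t - t * cos t) by (rewrite sin_0 in *; lra).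
  apply (le_of_derive_nonneg (fun x => sin x - x * cos x) (fun x => x * sin x)).
  - lra.
  - intros x _. auto_derive; trivial. ring.
  - intros x Hx. assert (0 <= sin x) by (apply sin_ge_0; lra). nra.
Qed.

(** Up to a positive factor, the expression is minus the derivative of [sin t / t * exp (t^2 / 6)].
    Its own derivative is [t / 3] times the expression of [sin_sub_mul_cos_nonneg]. *)
Lemma sin_sub_mul_cos_ge (t : R) :
  0 <= t <= PI -> 0 <= sin t - t * cos t - t * t / 3 * sin t.
Proof.
  intros Ht.
  enough (sin 0 - 0 * cos 0 - 0 * 0 / 3 * sin 0 <= sin t - t * cos t - t * t / 3 * sin t)
    by (rewrite sin_0 in *; lra).
  apply (le_of_derive_nonneg (fun x => sin x - x * cos x - x * x / 3 * sin x)
           (fun x => x / 3 * (sin x - x * cos x))).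
  - lra.
  - intros x _. auto_derive; trivial. field.
  - intros x Hx. pose proof (sin_sub_mul_cos_nonneg x ltac:(lra)). nra.
Qed.

Lemma exp_ge_1_plus (x : R) : 1 + x <= exp x.
Proof.
  destruct (Req_dec x 0) as [-> | Hx]; [rewrite exp_0; lra |].
  left. now apply exp_ineq1.
Qed.

(* [sin t / t * exp (t^2 / 6)] is nonincreasing on [(0, PI]]. *)
Lemma sinc_decay (h m : R) :
  0 < h <= m -> m <= PI ->
  h * sin m * (1 + (m * m - h * h) / 6) <= m * sin h.
Proof.
  intros Hh Hm.
  assert (Hmono : - (sin h / h * exp (h * h / 6)) <= - (sin m / m * exp (m * m / 6))).
  { apply (le_of_derive_nonneg (fun t => - (sin t / t * exp (t * t / 6)))
             (fun t => exp (t * t / 6) / (t * t) * (sin t - t * cos t - t * t / 3 * sin t))).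
    - lra.
    - intros t Ht. auto_derive; [lra |]. unfold Rdiv. field. lra.
    - intros t Ht. apply Rmult_le_pos.
      + apply Rlt_le, Rdiv_lt_0_compat; [apply exp_pos | nra].
      + apply sin_sub_mul_cos_ge. lra. }
  assert (Hs : 0 <= sin m) by (apply sin_ge_0; lra).
  assert (He : exp (m * m / 6) = exp (h * h / 6) * exp ((m * m - h * h) / 6))
    by (rewrite <- exp_plus; f_equal; field).
  rewrite He in Hmono.
  assert (Hexp := exp_ge_1_plus ((m * m - h * h) / 6)).
  assert (Hp := exp_pos (h * h / 6)).
  set (E := exp ((m * m - h * h) / 6)) in *.
  assert (H1 : sin m / m * E <= sin h / h).
  { apply Rmult_le_reg_l with (exp (h * h / 6)); [exact Hp | lra]. }
  assert (H2 : h * sin m * E <= m * sin h).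
  { apply (Rmult_le_compat_l (h * m)) in H1; [| nra].
    replace (h * m * (sin m / m * E)) with (h * sin m * E) in H1 by (field; lra).
    replace (h * m * (sin h / h)) with (m * sin h) in H1 by (field; lra). exact H1. }
  apply Rle_trans with (2 := H2). apply Rmult_le_compat_l; nra.
Qed.

(** The case [m = PI / 2] of [sinc_decay], with the quadratic gain dropped. *)
Lemma sin_jordan (h : R) : 0 <= h <= PI / 2 -> 2 * h <= PI * sin h.
Proof.
  intros Hh. pose proof PI_RGT_0.
  destruct (Req_dec h 0) as [-> | Hh0]; [rewrite sin_0; lra |].
  assert (Hc := sinc_decay h (PI / 2) ltac:(lra) ltac:(lra)).
  rewrite sin_PI2 in Hc.
  assert (0 <= (PI / 2 * (PI / 2) - h * h) / 6) by nra.
  nra.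
Qed.

(** Quantifies the expansion factor [y / |sin y|] of the hyperbolic metric. Up to [PI], two
    differentiations reduce the bound to [sin t >= t cos t]; beyond, [|sin y| <= 1] and
    [1 + e <= 2 < y]. *)
Lemma sin_le_id_defect (y e : R) :
  0 < y -> 0 <= e <= 1 -> e <= y * y / 6 -> (1 + e) * Rabs (sin y) <= y.
Proof.
  intros Hy He Hey. pose proof PI_RGT_0. pose proof PI2_3_2.
  destruct (Rle_dec y PI) as [Hle | Hgt].
  - assert (0 <= sin y) by (apply sin_ge_0; lra).
    rewrite Rabs_right by lra.
    enough (0 - sin 0 * (1 + 0 * 0 / 6) <= y - sin y * (1 + y * y / 6))
      by (rewrite sin_0 in *; nra).
    apply (le_of_derive_nonneg (fun t => t - sin t * (1 + t * t / 6))
             (fun t => 1 - cos t * (1 + t * t / 6) - t / 3 * sin t)).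
    + lra.
    + intros t _. auto_derive; trivial. field.
    + intros t Ht.
      enough (1 - cos 0 * (1 + 0 * 0 / 6) - 0 / 3 * sin 0
                <= 1 - cos t * (1 + t * t / 6) - t / 3 * sin t)
        by (rewrite cos_0, sin_0 in *; lra).
      apply (le_of_derive_nonneg (fun t => 1 - cos t * (1 + t * t / 6) - t / 3 * sin t)
               (fun t => 2 / 3 * (sin t - t * cos t) + t * t / 6 * sin t)).
      * lra.
      * intros s _. auto_derive; trivial. field.
      * intros s Hs. assert (0 <= sin s) by (apply sin_ge_0; lra).
        pose proof (sin_sub_mul_cos_nonneg s ltac:(lra)). nra.
  - assert (Rabs (sin y) <= 1) by (apply Rabs_le; apply SIN_bound).
    pose proof (Rabs_pos (sin y)). nra.
Qed.

(** Here [m] is the mean and [h] half the difference of two heights, and [s = (h / m)^2]. The decay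
    of [sin t / t] only yields the factor [1 + e (1 - s)]; the missing part is paid for by the term
    [e h^2 sin^2 h] that moves over from the left-hand side. *)
Lemma sin_expansion_half (m h e : R) :
  0 < h < m -> h < PI / 2 -> 0 <= e <= 1 -> e <= m * m / 6 ->
  (1 + e) * (h * h) * (sin m * sin m - sin h * sin h) <= (m * m - h * h) * (sin h * sin h).
Proof.
  intros Hh Hh2 He Hem. pose proof PI_RGT_0. pose proof PI2_3_2.
  assert (Hsh : 0 < sin h) by (apply sin_gt_0; lra).
  set (s := h * h / (m * m)).
  assert (Hs : 0 < s < 1).
  { unfold s. split; [apply Rdiv_lt_0_compat; nra |].
    apply Rmult_lt_reg_r with (m * m); [nra |]. field_simplify; nra. }
  assert (Hsm : s * (m * m) = h * h) by (unfold s; field; lra).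
  assert (Hkey : h * Rabs (sin m) * (1 + e * (1 - s)) <= m * sin h).
  { destruct (Rle_dec m PI) as [Hle | Hgt].
    - assert (0 <= sin m) by (apply sin_ge_0; lra).
      rewrite Rabs_right by lra.
      apply Rle_trans with (2 := sinc_decay h m ltac:(lra) Hle).
      apply Rmult_le_compat_l; [nra |].
      enough (e * (1 - s) <= m * m / 6 * (1 - s)) by nra.
      apply Rmult_le_compat_r; lra.
    (* Beyond [PI] the extra factor is at most 2, and Jordan's inequality gives
       [2 h <= PI sin h <= m sin h]. *)
    - assert (Rabs (sin m) <= 1) by (apply Rabs_le; apply SIN_bound).
      pose proof (Rabs_pos (sin m)).
      pose proof (sin_jordan h ltac:(lra)).
      assert (1 + e * (1 - s) <= 2) by nra.
      assert (1 <= 1 + e * (1 - s)) by nra.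
      apply Rle_trans with (h * 1 * 2).
      + apply Rmult_le_compat; nra.
      + nra. }
  assert (Hsq : (h * h) * (sin m * sin m) * ((1 + e * (1 - s)) * (1 + e * (1 - s)))
                  <= (m * m) * (sin h * sin h)).
  { replace (sin m * sin m) with (Rabs (sin m) * Rabs (sin m))
      by (rewrite <- Rabs_mult; apply Rabs_right; nra).
    pose proof (Rabs_pos (sin m)).
    assert (0 <= h * Rabs (sin m) * (1 + e * (1 - s))).
    { apply Rmult_le_pos; nra. }
    nra. }
  set (P := (h * h) * (sin m * sin m)) in *.
  assert (HP : 0 <= P) by (unfold P; apply Rmult_le_pos; nra).
  set (D := 1 + e * (1 - s)) in *.
  assert (HD : 1 <= D) by (unfold D; nra).
  (* Already [D (1 + e s) = 1 + e + e^2 s (1 - s)], and [D >= 1]. *)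
  assert (H1e : 1 + e <= D * D * (1 + e * s)).
  { apply Rle_trans with (D * (1 + e * s)).
    - unfold D. assert (0 <= e * e * (s * (1 - s))) by (apply Rmult_le_pos; nra). nra.
    - assert (0 <= e * s) by nra. apply Rmult_le_compat_r; nra. }
  assert (Hfin : P * (1 + e) <= (m * m) * (sin h * sin h) * (1 + e * s)).
  { apply Rle_trans with (P * (D * D * (1 + e * s))).
    - now apply Rmult_le_compat_l.
    - rewrite <- Rmult_assoc. apply Rmult_le_compat_r; [nra | exact Hsq]. }
  assert ((m * m) * (sin h * sin h) * (1 + e * s) = (sin h * sin h) * (m * m + e * (h * h)))
    by (rewrite <- Hsm; ring).
  unfold P in *. nra.
Qed.

Lemma sin_mul_sin (y y' : R) :
  sin y * sin y' =
  sin ((y + y') / 2) * sin ((y + y') / 2) - sin ((y - y') / 2) * sin ((y - y') / 2).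
Proof.
  set (m := (y + y') / 2). set (h := (y - y') / 2).
  replace y with (m + h) by (unfold m, h; field).
  replace y' with (m - h) by (unfold m, h; field).
  rewrite sin_plus, sin_minus.
  pose proof (sin2_cos2 m). pose proof (sin2_cos2 h). unfold Rsqr in *.
  transitivity (sin m * sin m * (cos h * cos h) - (cos m * cos m) * (sin h * sin h)); [ring |].
  replace (cos m * cos m) with (1 - sin m * sin m) by lra.
  replace (cos h * cos h) with (1 - sin h * sin h) by lra. ring.
Qed.

(** The vertical part of the expansion estimate: [sin_mul_sin] rewrites it in terms of the mean and
    the half difference of the heights. *)
Lemma sin_expansion (y y' e : R) :
  0 < y -> 0 < y' -> Rabs (y - y') < PI -> 0 <= e <= 1 -> e <= y * y / 24 ->
  (1 + e) * ((y - y') * (y - y')) * (sin y * sin y') <=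
  y * y' * (4 * (sin ((y - y') / 2) * sin ((y - y') / 2))).
Proof.
  intros Hy Hy' Hd He Hey.
  rewrite sin_mul_sin.
  set (m := (y + y') / 2). set (h := (y - y') / 2).
  assert (Hym : y = m + h) by (unfold m, h; field).
  assert (Hym' : y' = m - h) by (unfold m, h; field).
  replace (y - y') with (2 * h) in * by lra.
  replace (y * y') with (m * m - h * h) by (rewrite Hym, Hym'; ring).
  (* Since [y' > 0], the mean exceeds [y / 2]; hence the constant 24. *)
  assert (Hem : e <= m * m / 6) by nra.
  rewrite Rabs_mult, (Rabs_right 2) in Hd by lra.
  enough ((1 + e) * (h * h) * (sin m * sin m - sin h * sin h)
            <= (m * m - h * h) * (sin h * sin h)) by lra.
  destruct (Rtotal_order h 0) as [Hh | [Hh | Hh]].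
  - rewrite Rabs_left in Hd by lra.
    assert (H := sin_expansion_half m (- h) e ltac:(lra) ltac:(lra) He Hem).
    rewrite sin_neg in H. lra.
  - rewrite Hh, sin_0. lra.
  - rewrite Rabs_right in Hd by lra.
    apply sin_expansion_half; lra.
Qed.

(** * Euclidean distance in the plane, squared to keep estimates polynomial *)

Definition sqdist (z w : C) : R :=
  (fst z - fst w) * (fst z - fst w) + (snd z - snd w) * (snd z - snd w).

Lemma sqdist_nonneg (z w : C) : 0 <= sqdist z w.
Proof. apply Rplus_le_le_0_compat; apply Rle_0_sqr. Qed.

Lemma Cdist_nonneg (z w : C) : 0 <= Cdist z w.
Proof. apply sqrt_pos. Qed.

Lemma Cdist_sqr (z w : C) : Cdist z w * Cdist z w = sqdist z w.
Proof. unfold Cdist, Cmod. simpl. apply sqrt_sqrt, sqdist_nonneg. Qed.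

Lemma Cdist_le_sqr (z w : C) (r : R) : 0 <= r -> sqdist z w <= r * r -> Cdist z w <= r.
Proof. rewrite <- Cdist_sqr. pose proof (Cdist_nonneg z w). nra. Qed.

Lemma Cdist_refl (z : C) : Cdist z z = 0.
Proof.
  pose proof (Cdist_nonneg z z). pose proof (Cdist_sqr z z).
  assert (sqdist z z = 0) by (unfold sqdist; ring). nra.
Qed.

Lemma Cdist_sym (z w : C) : Cdist z w = Cdist w z.
Proof. unfold Cdist, Cmod. simpl. f_equal. ring. Qed.

Lemma Cdist_triangle (z w v : C) : Cdist z v <= Cdist z w + Cdist w v.
Proof.
  pose proof (triangle (fst z) (snd z) (fst v) (snd v) (fst w) (snd w)) as H.
  unfold dist_euc, Rsqr in H. exact H.
Qed.

Lemma Cdist_eq_0 (z w : C) : Cdist z w <= 0 -> z = w.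
Proof.
  intros H. pose proof (Cdist_nonneg z w). pose proof (Cdist_sqr z w) as Hs.
  destruct z as [x y], w as [x' y']. unfold sqdist in Hs. simpl in Hs.
  assert (Cdist (x, y) (x', y') = 0) as E by lra. rewrite E in Hs.
  destruct (Rplus_sqr_eq_0 (x - x') (y - y')) as [H1 H2]; [unfold Rsqr; lra |].
  f_equal; lra.
Qed.

Lemma Rabs_fst_le_Cdist (z w : C) : Rabs (fst z - fst w) <= Cdist z w.
Proof.
  apply Rsqr_incr_0_var; [| apply Cdist_nonneg].
  rewrite <- Rsqr_abs. unfold Rsqr. rewrite Cdist_sqr. unfold sqdist.
  pose proof (Rle_0_sqr (snd z - snd w)) as H. unfold Rsqr in H. lra.
Qed.

Lemma Rabs_snd_le_Cdist (z w : C) : Rabs (snd z - snd w) <= Cdist z w.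
Proof.
  apply Rsqr_incr_0_var; [| apply Cdist_nonneg].
  rewrite <- Rsqr_abs. unfold Rsqr. rewrite Cdist_sqr. unfold sqdist.
  pose proof (Rle_0_sqr (fst z - fst w)) as H. unfold Rsqr in H. lra.
Qed.

Lemma Cmod_sqr (z : C) : Cmod z * Cmod z = fst z * fst z + snd z * snd z.
Proof. apply sqrt_sqrt, Rplus_le_le_0_compat; apply Rle_0_sqr. Qed.

Lemma Cmod_Cdist (z : C) : Cmod z = Cdist z (0, 0).
Proof. unfold Cdist. simpl. f_equal. destruct z; simpl; f_equal; ring. Qed.

Lemma Cmod_pos (b : C) : b <> (0, 0) -> 0 < Cmod b.
Proof.
  intros Hb. apply Rnot_le_lt. intros H. apply Hb, Cdist_eq_0.
  rewrite <- Cmod_Cdist. exact H.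
Qed.

(** * The exponential map and its logarithms *)

Lemma Cmod_Cexp (z : C) : Cmod (Cexp z) = exp (fst z).
Proof.
  unfold Cmod, Cexp. simpl.
  replace (exp (fst z) * cos (snd z) * (exp (fst z) * cos (snd z)) +
           exp (fst z) * sin (snd z) * (exp (fst z) * sin (snd z)))
    with (exp (fst z) * exp (fst z) * (Rsqr (sin (snd z)) + Rsqr (cos (snd z))))
    by (unfold Rsqr; ring).
  rewrite sin2_cos2, Rmult_1_r. apply sqrt_square, Rlt_le, exp_pos.
Qed.

(** Amounts to [e^z - e^w = 2 e^((z+w)/2) sinh ((z-w)/2)] with
    [|sinh (u + i v)|^2 = sinh^2 u + sin^2 v], checked in real coordinates. *)
Lemma sqdist_Cexp (z w : C) :
  let d := (fst z - fst w) / 2 in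
  sqdist (Cexp z) (Cexp w) =
  exp (fst z + fst w) *
    ((exp d - exp (- d)) * (exp d - exp (- d))
     + 4 * (sin ((snd z - snd w) / 2) * sin ((snd z - snd w) / 2))).
Proof.
  intros d. destruct z as [x y], w as [x' y']. unfold sqdist, Cexp in *. simpl in *.
  set (h := (y - y') / 2).
  assert (Hx : exp x = exp (x') * (exp d * exp d))
    by (rewrite <- !exp_plus; f_equal; unfold d; field).
  assert (Hd : exp d * exp (- d) = 1) by (rewrite <- exp_plus, Rplus_opp_r; apply exp_0).
  assert (Hc : cos y * cos y' + sin y * sin y' = 1 - 2 * (sin h * sin h)).
  { rewrite <- cos_minus. replace (y - y') with (2 * h) by (unfold h; field).
    rewrite cos_2a_sin. ring. }
  pose proof (sin2_cos2 y) as Hy. pose proof (sin2_cos2 y') as Hy'. unfold Rsqr in Hy, Hy'.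
  rewrite exp_plus.
  transitivity (exp x * exp x * (sin y * sin y + cos y * cos y)
                + exp x' * exp x' * (sin y' * sin y' + cos y' * cos y')
                - 2 * exp x * exp x' * (cos y * cos y' + sin y * sin y')); [ring |].
  rewrite Hy, Hy', Hc, Hx.
  set (E := exp x'). set (D := exp d) in *. set (D' := exp (- d)) in *.
  transitivity (E * E * (D * D * (D * D) + 1 - 2 * (D * D) + 4 * (D * D) * (sin h * sin h)));
    [ring |].
  replace ((D - D') * (D - D')) with (D * D - 2 * (D * D') + D' * D') by ring.
  transitivity (E * E * (D * D * (D * D) + (D * D') * (D * D') - 2 * (D * D) * (D * D')
     + 4 * (D * D) * (sin h * sin h))); [| ring].
  rewrite Hd. ring.
Qed.

Lemma sqdist_Cexp_ge (z w : C) :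
  exp (fst z + fst w) *
    ((fst z - fst w) * (fst z - fst w)
     + 4 * (sin ((snd z - snd w) / 2) * sin ((snd z - snd w) / 2)))
  <= sqdist (Cexp z) (Cexp w).
Proof.
  rewrite sqdist_Cexp. apply Rmult_le_compat_l; [apply Rlt_le, exp_pos |].
  pose proof (sqr_sinh_ge ((fst z - fst w) / 2)). lra.
Qed.

Lemma exists_nearest_multiple (y T : R) : 0 < T -> exists k : Z, Rabs (y - IZR k * T) <= T / 2.
Proof.
  intros HT. exists (up (y / T - 1 / 2)).
  destruct (archimed (y / T - 1 / 2)) as [H1 H2].
  set (k := IZR (up (y / T - 1 / 2))) in *.
  assert (Hy : y = y / T * T) by (field; lra).
  set (q := y / T) in *. rewrite Hy. apply Rabs_le. split; nra.
Qed.

Lemma Cexp_shift (x y : R) (k : Z) : Cexp (x, y + IZR k * (2 * PI)) = Cexp (x, y).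
Proof.
  unfold Cexp. simpl.
  assert (H : forall n : nat, forall t, sin (t + INR n * (2 * PI)) = sin t /\
                             cos (t + INR n * (2 * PI)) = cos t).
  { intros n t. replace (t + INR n * (2 * PI)) with (t + 2 * INR n * PI) by ring.
    split; [apply sin_period | apply cos_period]. }
  destruct (Z.le_ge_cases 0 k) as [Hk | Hk].
  - destruct (IZN k Hk) as [n ->]. rewrite <- INR_IZR_INZ.
    destruct (H n y) as [-> ->]. reflexivity.
  - destruct (IZN (- k) ltac:(lia)) as [n Hn].
    destruct (H n (y + IZR k * (2 * PI))) as [<- <-].
    rewrite INR_IZR_INZ, <- Hn, opp_IZR.
    replace (y + IZR k * (2 * PI) + - IZR k * (2 * PI)) with y by ring. reflexivity.
Qed.

Lemma exists_polar (a b : R) : a * a + b * b = 1 -> exists t, cos t = a /\ sin t = b.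
Proof.
  intros H.
  assert (Ha : -1 <= a <= 1) by nra.
  assert (Hs : sin (acos a) * sin (acos a) = b * b).
  { pose proof (sin2_cos2 (acos a)) as H2. rewrite cos_acos in H2 by lra.
    unfold Rsqr in H2. lra. }
  assert (0 <= sin (acos a)) by (apply sin_ge_0; apply acos_bound).
  destruct (Rle_dec 0 b) as [Hb | Hb].
  - exists (acos a). split; [apply cos_acos; lra | nra].
  - exists (- acos a). rewrite cos_neg, sin_neg. split; [apply cos_acos; lra | nra].
Qed.

(** In place of one fixed branch of the logarithm, the branch is picked by a reference height [y],
    so that pulling back can follow a given orbit. *)
Lemma exists_log_near (p : C) (y : R) :
  p <> (0, 0) -> exists w, Cexp w = p /\ Rabs (snd w - y) <= PI.
Proof.
  intros Hp. destruct p as [a b].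
  pose proof (Cmod_sqr (a, b)) as Hm. simpl in Hm.
  pose proof (Cmod_pos _ Hp) as Hpos.
  set (m := Cmod (a, b)) in *.
  destruct (exists_polar (a / m) (b / m)) as [t [Hc Hs]].
  { replace (a / m * (a / m) + b / m * (b / m)) with ((a * a + b * b) / (m * m))
      by (field; lra). rewrite <- Hm. field. lra. }
  destruct (exists_nearest_multiple (y - t) (2 * PI)) as [k Hk].
  { pose proof PI_RGT_0. lra. }
  exists (ln m, t + IZR k * (2 * PI)). split.
  - rewrite Cexp_shift. unfold Cexp. simpl. rewrite exp_ln, Hc, Hs by assumption.
    f_equal; field; lra.
  - simpl. rewrite Rabs_minus_sym.
    replace (y - (t + IZR k * (2 * PI))) with (y - t - IZR k * (2 * PI)) by ring. lra.
Qed.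

(** * Expansion of the hyperbolic metric *)

(** At distance exactly [PI] the sines would be opposite. Heights on opposite sides of [0] and less
    than [PI] apart lie in [[-PI, PI]], where [sin] has the sign of its argument. *)
Lemma same_strip (y y' : R) :
  Rabs (y' - y) <= PI -> 0 < sin y * sin y' -> Rabs (y - y') < PI /\ 0 < y * y'.
Proof.
  intros Hd Hs. rewrite Rabs_minus_sym in Hd. pose proof PI_RGT_0.
  assert (Hne : Rabs (y - y') <> PI).
  { intros E. assert (sin y' = - sin y).
    { unfold Rabs in E. destruct (Rcase_abs (y - y')).
      - replace y' with (y + PI) by lra. apply neg_sin.
      - replace y with (y' + PI) by lra. rewrite neg_sin. ring. }
    nra. }
  assert (Hlt : Rabs (y - y') < PI) by lra. split; [exact Hlt |].
  apply Rabs_def2 in Hlt.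
  destruct (Rtotal_order y 0) as [Hy | [-> | Hy]]; [| rewrite sin_0 in Hs; lra |].
  - destruct (Rlt_dec y' 0) as [Hy' | Hy']; [nra |]. exfalso.
    assert (0 <= sin y') by (apply sin_ge_0; lra).
    assert (0 <= sin (- y)) by (apply sin_ge_0; lra). rewrite sin_neg in *. nra.
  - destruct (Rlt_dec 0 y') as [Hy' | Hy']; [nra |]. exfalso.
    assert (0 <= sin y) by (apply sin_ge_0; lra).
    assert (0 <= sin (- y')) by (apply sin_ge_0; lra). rewrite sin_neg in *. nra.
Qed.

(** With [d] the hyperbolic distance, [|z - w|^2 / (Im z Im w) = 4 sinh^2 (d / 2)]; the estimate
    says, without denominators, that [exp] multiplies this by at least [1 + e]. The horizontal part
    follows from [sin_le_id_defect], with the gain taken from the height of [z], and the vertical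
    part from [sin_expansion]. *)
Lemma hyperbolic_expansion_pos (z w : C) (e : R) :
  0 < snd z -> 0 < snd w -> Rabs (snd z - snd w) < PI ->
  0 < sin (snd z) * sin (snd w) -> 0 <= e <= 1 -> e <= snd z * snd z / 24 ->
  (1 + e) * sqdist z w * (snd (Cexp z) * snd (Cexp w))
  <= snd z * snd w * sqdist (Cexp z) (Cexp w).
Proof.
  intros Hz Hw Hd Hs He Hez.
  pose proof (sqdist_Cexp_ge z w) as Hge.
  pose proof (sin_expansion (snd z) (snd w) e Hz Hw Hd He Hez) as Hy.
  assert (Hx : (1 + e) * (sin (snd z) * sin (snd w)) <= snd z * snd w).
  { pose proof (sin_le_id_defect (snd z) e Hz He ltac:(nra)) as H1.
    pose proof (sin_le_id_defect (snd w) 0 Hw ltac:(lra) ltac:(nra)) as H2.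
    rewrite <- (Rabs_right (sin (snd z) * sin (snd w))), Rabs_mult by lra.
    pose proof (Rabs_pos (sin (snd z))). pose proof (Rabs_pos (sin (snd w))).
    rewrite <- Rmult_assoc. apply Rmult_le_compat; nra. }
  apply Rle_trans with (2 := Rmult_le_compat_l (snd z * snd w) _ _ ltac:(nra) Hge).
  unfold Cexp. simpl. rewrite exp_plus. unfold sqdist.
  pose proof (exp_pos (fst z)). pose proof (exp_pos (fst w)).
  set (E := exp (fst z)) in *. set (E' := exp (fst w)) in *.
  set (X := (fst z - fst w) * (fst z - fst w)).
  assert (0 <= X) by apply Rle_0_sqr.
  set (Y := (snd z - snd w) * (snd z - snd w)) in *.
  set (S := sin (snd z)) in *. set (S' := sin (snd w)) in *.
  set (V := 4 * (sin ((snd z - snd w) / 2) * sin ((snd z - snd w) / 2))) in *.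
  replace ((1 + e) * (X + Y) * (E * S * (E' * S')))
    with (E * E' * ((1 + e) * (S * S') * X + (1 + e) * Y * (S * S'))) by ring.
  replace (snd z * snd w * (E * E' * (X + V)))
    with (E * E' * (snd z * snd w * X + snd z * snd w * V)) by ring.
  apply Rmult_le_compat_l; [nra |].
  apply Rplus_le_compat; [| exact Hy]. apply Rmult_le_compat_r; assumption.
Qed.

(** Complex conjugation commutes with [Cexp] and carries the lower half-plane to the upper one. *)
Lemma hyperbolic_expansion (z w : C) (e : R) :
  Rabs (snd w - snd z) <= PI ->
  0 < sin (snd z) * sin (snd w) -> 0 <= e <= 1 -> e <= snd z * snd z / 24 ->
  (1 + e) * sqdist z w * (snd (Cexp z) * snd (Cexp w))
  <= snd z * snd w * sqdist (Cexp z) (Cexp w).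
Proof.
  intros Hd Hs He Hez. destruct (same_strip _ _ Hd Hs) as [Hd' Hp].
  destruct (Rlt_dec 0 (snd z)) as [Hz | Hz].
  - apply hyperbolic_expansion_pos; trivial. nra.
  - destruct z as [x y], w as [x' y']. simpl in *.
    assert (H := hyperbolic_expansion_pos (x, - y) (x', - y') e).
    unfold sqdist, Cexp in *. simpl in *. rewrite !sin_neg, !cos_neg in H.
    replace (- y - - y') with (- (y - y')) in H by ring.
    rewrite Rabs_Ropp in H.
    assert (Hy : y < 0) by (destruct (Req_dec y 0) as [-> |]; lra).
    assert (Hy' : y' < 0) by nra.
    specialize (H ltac:(lra) ltac:(lra) Hd' ltac:(lra) He ltac:(lra)). lra.
Qed.

(** * Orbits off the real axis: recurrence of heights and growth of hyperbolic discs *)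

Lemma orbit_S (z : C) (n : nat) : orbit z (S n) = Cexp (orbit z n).
Proof. reflexivity. Qed.

Lemma orbit_plus (z : C) (m n : nat) : orbit z (m + n) = orbit (orbit z n) m.
Proof. apply Nat.iter_add. Qed.

(** From [exp (1 / 7) >= 8 / 7] and [exp (x - 1 / 7) >= x + 6 / 7]. The factor [7 / 8] is the lower
    bound for [cos] at heights below [1 / 2]. *)
Lemma exp_large_gap (x : R) : x + 6 / 7 <= 7 / 8 * exp x.
Proof.
  pose proof (exp_ge_1_plus (1 / 7)). pose proof (exp_ge_1_plus (x - 1 / 7)).
  pose proof (exp_pos (x - 1 / 7)).
  replace x with (1 / 7 + (x - 1 / 7)) at 2 by ring. rewrite exp_plus. nra.
Qed.

Lemma cos_ge_7_8 (y : R) : Rabs y < 1 / 2 -> 7 / 8 <= cos y.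
Proof.
  intros Hy. apply Rabs_def2 in Hy.
  replace y with (2 * (y / 2)) by field. rewrite cos_2a_sin.
  assert (Hs : Rabs (sin (y / 2)) <= Rabs (y / 2)).
  { destruct (Rtotal_order (y / 2) 0) as [H | [-> | H]].
    - pose proof (sin_le_id_defect (- (y / 2)) 0 ltac:(lra) ltac:(lra) ltac:(nra)).
      rewrite sin_neg, Rabs_Ropp in *. rewrite (Rabs_left (y / 2)); lra.
    - rewrite sin_0. lra.
    - pose proof (sin_le_id_defect (y / 2) 0 ltac:(lra) ltac:(lra) ltac:(nra)).
      rewrite (Rabs_right (y / 2)); lra. }
  apply Rsqr_le_abs_1 in Hs. unfold Rsqr in Hs. nra.
Qed.

Lemma Rabs_sin_ge (y : R) : Rabs y < 1 / 2 -> Rabs y / 2 <= Rabs (sin y).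
Proof.
  intros Hy. pose proof PI2_3_2. pose proof PI_4.
  assert (Hpos : forall t, 0 <= t < 1 / 2 -> t / 2 <= sin t).
  { intros t Ht. pose proof (sin_jordan t ltac:(lra)). nra. }
  unfold Rabs in *. destruct (Rcase_abs y), (Rcase_abs (sin y));
    try (pose proof (Hpos y ltac:(lra)); lra);
    pose proof (Hpos (- y) ltac:(lra)) as H1; rewrite sin_neg in H1; lra.
Qed.

(** If all heights from time [n] on were below [1 / 2], the real part would gain [6 / 7] per step;
    once it is at least 2, every step multiplies the nonzero height by at least [3 / 2], which is
    absurd. *)
Lemma imaginary_part_recurs (z : C) (n : nat) :
  (forall k, snd (orbit z k) <> 0) ->
  exists m, (n <= m)%nat /\ 1 / 2 <= Rabs (snd (orbit z m)).
Proof.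
  intros Hne. apply NNPP. intros Hno.
  assert (Hsmall : forall m, (n <= m)%nat -> Rabs (snd (orbit z m)) < 1 / 2).
  { intros m Hm. apply Rnot_le_lt. intros H. apply Hno. eauto. }
  assert (Hx : forall k, fst (orbit z n) + INR k * (6 / 7) <= fst (orbit z (n + k))).
  { induction k as [| k IH]; [rewrite Nat.add_0_r; simpl; lra |].
    rewrite Nat.add_succ_r, orbit_S, S_INR. unfold Cexp. simpl.
    pose proof (cos_ge_7_8 _ (Hsmall (n + k)%nat ltac:(lia))).
    pose proof (exp_large_gap (fst (orbit z (n + k)))).
    pose proof (exp_pos (fst (orbit z (n + k)))). nra. }
  destruct (INR_unbounded ((2 - fst (orbit z n)) * 2)) as [k0 Hk0].
  assert (Hx2 : forall k, 2 <= fst (orbit z (n + k0 + k))).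
  { intros k. rewrite <- Nat.add_assoc. eapply Rle_trans; [| apply Hx].
    rewrite plus_INR. pose proof (pos_INR k). pose proof (pos_INR k0). lra. }
  (* Linear growth suffices; it comes from [exp x >= 3] and [|sin y| >= |y| / 2]. *)
  assert (Hgrow : forall k, Rabs (snd (orbit z (n + k0))) * (1 + INR k / 2)
                              <= Rabs (snd (orbit z (n + k0 + k)))).
  { induction k as [| k IH]; [rewrite Nat.add_0_r; simpl; lra |].
    rewrite Nat.add_succ_r, orbit_S, S_INR. unfold Cexp. simpl.
    rewrite Rabs_mult, (Rabs_right (exp _)) by (apply Rle_ge, Rlt_le, exp_pos).
    pose proof (Rabs_sin_ge _ (Hsmall (n + k0 + k)%nat ltac:(lia))).
    pose proof (exp_ge_1_plus (fst (orbit z (n + k0 + k)))).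
    pose proof (Hx2 k). pose proof (pos_INR k).
    pose proof (Rabs_pos (snd (orbit z (n + k0)))).
    set (A := Rabs (snd (orbit z (n + k0)))) in *.
    set (B := Rabs (snd (orbit z (n + k0 + k)))) in *.
    apply Rle_trans with (3 * (B / 2)); [nra |].
    apply Rmult_le_compat; try lra. nra. }
  pose proof (Rabs_pos_lt _ (Hne (n + k0)%nat)) as Hpos.
  set (A := Rabs (snd (orbit z (n + k0)))) in *.
  destruct (INR_unbounded (1 / A)) as [k Hk].
  pose proof (Hgrow k). pose proof (Hsmall (n + k0 + k)%nat ltac:(lia)).
  assert (1 < INR k * A).
  { apply Rmult_lt_reg_r with (/ A); [now apply Rinv_0_lt_compat |].
    rewrite Rmult_assoc, Rinv_r; lra. }
  nra.
Qed.

(* The points [p] with [sqdist p z <= q * snd z * snd p] form the hyperbolic disc around [z]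
   in its half-plane, with [q = 4 sinh^2 (radius / 2)]. *)
Definition image_contains_hdisc (a : C) (r : R) (n : nat) (q : R) : Prop :=
  forall p, 0 < snd (orbit a n) * snd p ->
    sqdist (orbit a n) p <= q * (snd (orbit a n) * snd p) ->
    exists u, Cdist u a <= r /\ orbit u n = p.

(** At Euclidean distance [d] the product of heights is at most [Y (Y + d)], and [d^2 / (Y (Y + d))]
    increases with [d]; its value at [d = r] is the witness. *)
Lemma image_contains_hdisc_0 (a : C) (r : R) :
  0 < r -> snd a <> 0 -> exists q, 0 < q /\ image_contains_hdisc a r 0 q.
Proof.
  intros Hr Ha. pose proof (Rabs_pos_lt _ Ha) as Hy. set (Y := Rabs (snd a)) in *.
  assert (HD : 0 < Y * (Y + r)) by nra.
  exists (r * r / (Y * (Y + r))). split; [apply Rdiv_lt_0_compat; nra |].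
  intros p Hp Hd. exists p. split; [| reflexivity]. simpl in Hp, Hd.
  rewrite Cdist_sym. apply Rnot_lt_le. intros Hlt.
  rewrite <- Cdist_sqr in Hd. pose proof (Rabs_snd_le_Cdist a p) as Hs.
  set (d := Cdist a p) in *.
  assert (HP : snd a * snd p <= Y * (Y + d)).
  { rewrite <- (Rabs_right (snd a * snd p)), Rabs_mult by lra.
    apply Rmult_le_compat_l; [lra |].
    pose proof (Rabs_triang (snd a) (- (snd a - snd p))).
    rewrite Rabs_Ropp in *. replace (snd a + - (snd a - snd p)) with (snd p) in * by ring.
    unfold Y. lra. }
  assert (H1 : d * d * (Y * (Y + r)) <= r * r * (Y * (Y + d))).
  { apply Rle_trans with (r * r / (Y * (Y + r)) * (Y * (Y + d)) * (Y * (Y + r))).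
    - apply Rmult_le_compat_r; [lra |]. eapply Rle_trans; [exact Hd |].
      apply Rmult_le_compat_l; [| exact HP].
      apply Rlt_le, Rdiv_lt_0_compat; nra.
    - right. field. lra. }
  assert (H2 : r * r * (Y * (Y + d)) < d * d * (Y * (Y + r))); [| lra].
  assert (r * r < d * d) by nra. assert (0 < r * d) by nra.
  assert (r * r * d < d * d * r) by nra.
  assert (Y * (r * r * (Y + d)) < Y * (d * d * (Y + r))); [| lra].
  apply Rmult_lt_compat_l; [exact Hy | nra].
Qed.

(** A point of the larger disc has a logarithm with height within [PI] of that of the old centre,
    and the expansion estimate places this logarithm in the old disc. *)
Lemma image_contains_hdisc_S (a : C) (r : R) (n : nat) (q e : R) :
  snd (orbit a (S n)) <> 0 -> 0 <= e <= 1 ->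
  e <= snd (orbit a n) * snd (orbit a n) / 24 ->
  image_contains_hdisc a r n q -> image_contains_hdisc a r (S n) ((1 + e) * q).
Proof.
  intros Hne He Hey Hn p Hp Hd.
  assert (Hp0 : p <> (0, 0)) by (intros ->; simpl in Hp; lra).
  destruct (exists_log_near p (snd (orbit a n)) Hp0) as [w [Hw Hwy]].
  rewrite orbit_S in *. set (z := orbit a n) in *. rewrite <- Hw in Hp, Hd.
  assert (Hs : 0 < sin (snd z) * sin (snd w)).
  { unfold Cexp in Hp. simpl in Hp.
    pose proof (exp_pos (fst z)). pose proof (exp_pos (fst w)).
    apply Rmult_lt_reg_l with (exp (fst z) * exp (fst w)); nra. }
  destruct (same_strip _ _ Hwy Hs) as [_ Hzw].
  pose proof (hyperbolic_expansion z w e Hwy Hs He Hey) as Hexp.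
  destruct (Hn w Hzw) as [u [Hu Huw]].
  - fold z. set (P := snd (Cexp z) * snd (Cexp w)) in *.
    apply Rmult_le_reg_r with ((1 + e) * P); [nra |].
    apply Rle_trans with (snd z * snd w * sqdist (Cexp z) (Cexp w)); [lra |].
    apply Rle_trans with (snd z * snd w * ((1 + e) * q * P)); [| right; ring].
    apply Rmult_le_compat_l; lra.
  - exists u. split; [exact Hu |]. rewrite orbit_S, Huw. exact Hw.
Qed.

Lemma image_contains_hdisc_plus (a : C) (r : R) (n k : nat) (q : R) :
  (forall j, snd (orbit a j) <> 0) ->
  image_contains_hdisc a r n q -> image_contains_hdisc a r (n + k) q.
Proof.
  intros Hne Hn. induction k as [| k IH]; [now rewrite Nat.add_0_r |].
  rewrite Nat.add_succ_r. replace q with ((1 + 0) * q) by ring.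
  apply image_contains_hdisc_S; trivial; [lra |].
  pose proof (Rle_0_sqr (snd (orbit a (n + k)))) as H. unfold Rsqr in H. lra.
Qed.

(** The line [Im = Y] is mapped into the reals. The bounds put the point of that line vertically
    aligned with the centre inside every hyperbolic disc with [q >= 16]. *)
Lemma exists_multiple_PI_near (y : R) :
  1 / 2 <= Rabs y ->
  exists Y, sin Y = 0 /\ 1 <= y * Y /\ (y - Y) * (y - Y) <= 16.
Proof.
  assert (Hpos : forall t, 1 / 2 <= t ->
            exists Y, sin Y = 0 /\ 1 <= t * Y /\ (t - Y) * (t - Y) <= 16).
  { intros t Ht. pose proof PI2_3_2. pose proof PI_4.
    destruct (Rle_dec t PI) as [Hle | Hgt].
    (* The nearest multiple could be [0], which lies outside the half-plane. *)
    - exists PI. rewrite sin_PI. repeat split; nra.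
    - destruct (exists_nearest_multiple t PI PI_RGT_0) as [k Hk].
      exists (IZR k * PI). split; [apply sin_eq_0_1; now exists k |].
      apply Rabs_le_between in Hk. split; nra. }
  intros Hy. unfold Rabs in Hy. destruct (Rcase_abs y) as [Hn | Hn]; [| now apply Hpos].
  destruct (Hpos (- y) Hy) as [Y [H1 [H2 H3]]].
  exists (- Y). rewrite sin_neg. repeat split; lra.
Qed.

Lemma exists_real_in_orbit (a : C) (r : R) :
  0 < r -> exists u n, Cdist u a <= r /\ snd (orbit u n) = 0.
Proof.
  intros Hr. apply NNPP. intros Hno.
  assert (Hball : forall u n, Cdist u a <= r -> snd (orbit u n) <> 0)
    by (intros u n Hu H0; apply Hno; eauto).
  assert (Hne : forall j, snd (orbit a j) <> 0).
  { intros j. apply Hball. rewrite Cdist_refl. lra. }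
  destruct (image_contains_hdisc_0 a r Hr (Hne 0%nat)) as [q [Hq H0]].
  (* Each visit to height at least [1 / 2] allows [e = (1 / 2)^2 / 24 = 1 / 96]; between visits [q]
     is kept. *)
  assert (Hgrow : forall j, exists n, image_contains_hdisc a r n (q * (1 + INR j / 96))).
  { induction j as [| j [n IH]].
    - exists 0%nat. simpl. replace (q * (1 + 0 / 96)) with q by field. exact H0.
    - destruct (imaginary_part_recurs a n Hne) as [m [Hm Hy]].
      exists (S m). rewrite S_INR.
      apply (image_contains_hdisc_plus a r n (m - n)) in IH; [| exact Hne].
      replace (n + (m - n))%nat with m in IH by lia.
      apply (image_contains_hdisc_S a r m _ (1 / 96) (Hne (S m))) in IH; try lra.
      + intros p Hp Hd. apply IH; trivial. apply Rle_trans with (1 := Hd).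
        apply Rmult_le_compat_r; [lra |]. pose proof (pos_INR j). nra.
      + assert (Hsq : Rabs (snd (orbit a m)) * Rabs (snd (orbit a m))
                        = snd (orbit a m) * snd (orbit a m))
          by (rewrite <- Rabs_mult; apply Rabs_right; nra).
        nra. }
  destruct (INR_unbounded (96 * (16 / q))) as [j Hj].
  destruct (Hgrow j) as [n Hn].
  destruct (imaginary_part_recurs a n Hne) as [m [Hm Hy]].
  apply (image_contains_hdisc_plus a r n (m - n)) in Hn; [| exact Hne].
  replace (n + (m - n))%nat with m in Hn by lia.
  destruct (exists_multiple_PI_near _ Hy) as [Y [HY1 [HY2 HY3]]].
  assert (Hbig : 16 <= q * (1 + INR j / 96)).
  { apply Rle_trans with (q * (16 / q)); [right; field; lra |].
    apply Rmult_le_compat_l; lra. }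
  destruct (Hn (fst (orbit a m), Y)) as [u [Hu Huw]].
  - simpl. lra.
  - unfold sqdist. simpl. rewrite Rminus_diag, Rmult_0_l, Rplus_0_l.
    apply Rle_trans with (1 := HY3). nra.
  - apply (Hball u (S m) Hu). rewrite orbit_S, Huw. unfold Cexp. simpl.
    rewrite HY1. ring.
Qed.

(** * Inverse branches of iterates *)

(** A total function constrained only on the closed disc of radius [t] about [b]; contraction is
    recorded as a Lipschitz bound rather than through a derivative. *)
Definition inverse_branch (n : nat) (b : C) (t : R) (a : C) (r K : R) (g : C -> C) : Prop :=
  (forall p, Cdist p b <= t -> Cdist (g p) a <= r /\ orbit (g p) n = p) /\
  (forall p q, Cdist p b <= t -> Cdist q b <= t -> Cdist (g p) (g q) <= K * Cdist p q).

Definition has_inverse_branch (n : nat) (b : C) (t : R) (a : C) (r K : R) : Prop :=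
  exists g, inverse_branch n b t a r K g.

Lemma has_inverse_branch_comp (m n : nat) (c b a : C) (s t t' r K K' : R) :
  has_inverse_branch n b t a r K -> has_inverse_branch m c s b t' K' ->
  t' <= t -> 0 <= K ->
  has_inverse_branch (m + n) c s a r (K * K').
Proof.
  intros [g [Hg Hgl]] [g' [Hg' Hgl']] Ht HK.
  exists (fun p => g (g' p)). split.
  - intros p Hp. destruct (Hg' p Hp) as [H1 H2].
    destruct (Hg (g' p) ltac:(lra)) as [H3 H4].
    split; [exact H3 |]. rewrite orbit_plus, H4. exact H2.
  - intros p q Hp Hq. destruct (Hg' p Hp) as [H1 _]. destruct (Hg' q Hq) as [H2 _].
    eapply Rle_trans; [apply Hgl; lra |]. rewrite Rmult_assoc.
    apply Rmult_le_compat_l; auto.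
Qed.

Lemma has_inverse_branch_weaken (n : nat) (b a : C) (t t' r K K' : R) :
  has_inverse_branch n b t a r K -> t' <= t -> K <= K' ->
  has_inverse_branch n b t' a r K'.
Proof.
  intros [g [Hg Hgl]] Ht HK. exists g. split.
  - intros p Hp. apply Hg. lra.
  - intros p q Hp Hq. eapply Rle_trans; [apply Hgl; lra |].
    apply Rmult_le_compat_r; [apply Cdist_nonneg | exact HK].
Qed.

Lemma has_inverse_branch_recenter (n : nat) (b a a' : C) (t r r' K : R) :
  has_inverse_branch n b t a r K -> Cdist a a' + r <= r' ->
  has_inverse_branch n b t a' r' K.
Proof.
  intros [g [Hg Hgl]] Hr. exists g. split; [| exact Hgl].
  intros p Hp. destruct (Hg p Hp) as [H1 H2]. split; [| exact H2].
  pose proof (Cdist_triangle (g p) a a'). lra.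
Qed.

(* [|e^z - e^w|^2 >= |e^z| |e^w| (dx^2 + 4 sin^2 (dy / 2))] and Jordan's inequality. *)
Lemma Cexp_sep (z w : C) :
  Rabs (snd z - snd w) <= PI ->
  exp (fst z) * exp (fst w) * sqdist z w <= 4 * sqdist (Cexp z) (Cexp w).
Proof.
  intros Hd. pose proof (sqdist_Cexp_ge z w) as H. rewrite exp_plus in H.
  pose proof (exp_pos (fst z)). pose proof (exp_pos (fst w)).
  set (E := exp (fst z) * exp (fst w)) in *.
  assert (HE : 0 < E) by (unfold E; nra).
  pose proof PI_4. pose proof PI_RGT_0.
  assert (Hs : (snd z - snd w) * (snd z - snd w) <=
               16 * (sin ((snd z - snd w) / 2) * sin ((snd z - snd w) / 2))).
  { assert (Hpos : forall t, 0 <= t <= PI -> t * t <= 16 * (sin (t / 2) * sin (t / 2))).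
    { intros t Ht. pose proof (sin_jordan (t / 2) ltac:(lra)).
      assert (0 <= sin (t / 2)) by (apply sin_ge_0; lra).
      assert (t <= 4 * sin (t / 2)) by nra. nra. }
    apply Rabs_le_between in Hd.
    destruct (Rle_dec 0 (snd z - snd w)) as [Hp | Hn].
    - apply Hpos. lra.
    - specialize (Hpos (- (snd z - snd w)) ltac:(lra)).
      replace (- (snd z - snd w) / 2) with (- ((snd z - snd w) / 2)) in Hpos by field.
      rewrite sin_neg in Hpos. lra. }
  unfold sqdist at 1.
  pose proof (Rle_0_sqr (fst z - fst w)) as Hx. unfold Rsqr in Hx.
  apply Rle_trans with (4 * (E * ((fst z - fst w) * (fst z - fst w)
     + 4 * (sin ((snd z - snd w) / 2) * sin ((snd z - snd w) / 2))))); [| lra].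
  rewrite <- (Rmult_assoc 4), (Rmult_comm 4 E), Rmult_assoc.
  apply Rmult_le_compat_l; lra.
Qed.

(** The modulus bound is the triangle inequality. If the arguments differed by more than [PI / 2],
    the law of cosines would give [|e^v - e^w| > |e^w|]. Two such logarithms are then at most [PI]
    apart in height, as [Cexp_sep] requires. *)
Lemma Cexp_ball_bounds (w v : C) :
  Rabs (snd v - snd w) <= PI ->
  Cdist (Cexp v) (Cexp w) <= exp (fst w) / 2 ->
  exp (fst w) / 2 <= exp (fst v) /\ Rabs (snd v - snd w) <= PI / 2.
Proof.
  intros Hd Hp. pose proof (exp_pos (fst w)) as HE. pose proof (exp_pos (fst v)) as HE'.
  split.
  - pose proof (Cdist_triangle (Cexp w) (Cexp v) (0, 0)) as H.
    rewrite <- !Cmod_Cdist, !Cmod_Cexp, (Cdist_sym (Cexp w)) in H. lra.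
  - apply Rnot_lt_le. intros Hlt. pose proof PI_RGT_0.
    assert (Hc : cos (snd v - snd w) <= 0).
    { assert (Hpos : forall t, PI / 2 < t <= PI -> cos t <= 0)
        by (intros t Ht; apply cos_le_0; lra).
      unfold Rabs in *. destruct (Rcase_abs (snd v - snd w)).
      - rewrite <- cos_neg. apply Hpos. lra.
      - apply Hpos. lra. }
    pose proof (Cdist_sqr (Cexp v) (Cexp w)) as Hsq.
    pose proof (Cdist_nonneg (Cexp v) (Cexp w)).
    unfold sqdist, Cexp in Hsq. simpl in Hsq. rewrite cos_minus in Hc.
    pose proof (sin2_cos2 (snd v)) as Hv. pose proof (sin2_cos2 (snd w)) as Hw.
    unfold Rsqr in Hv, Hw.
    set (E := exp (fst w)) in *. set (E' := exp (fst v)) in *.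
    assert (Hid : Cdist (Cexp v) (Cexp w) * Cdist (Cexp v) (Cexp w) =
       E' * E' + E * E - 2 * (E' * E) * (cos (snd v) * cos (snd w) + sin (snd v) * sin (snd w))).
    { unfold Cexp at 1 2 3 4. fold E E'. rewrite Hsq.
      replace (E' * E') with (E' * E' * (sin (snd v) * sin (snd v) + cos (snd v) * cos (snd v)))
        by (rewrite Hv; ring).
      replace (E * E) with (E * E * (sin (snd w) * sin (snd w) + cos (snd w) * cos (snd w)))
        by (rewrite Hw; ring). ring. }
    assert (0 < E' * E) by nra.
    set (c := cos (snd v) * cos (snd w) + sin (snd v) * sin (snd w)) in *.
    assert (0 <= - (E' * E * c)) by nra.
    assert (E * E < Cdist (Cexp v) (Cexp w) * Cdist (Cexp v) (Cexp w)) by nra.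
    nra.
Qed.

Lemma Cexp_inverse_branch (w : C) (t : R) :
  t <= exp (fst w) / 2 ->
  has_inverse_branch 1 (Cexp w) t w (4 * t / exp (fst w)) (4 / exp (fst w)).
Proof.
  intros Ht. pose proof (exp_pos (fst w)) as HE. set (E := exp (fst w)) in *.
  set (Q := fun p v => Cexp v = p /\ Rabs (snd v - snd w) <= PI).
  (* At [p = 0], which has no logarithm, [epsilon] returns an arbitrary value; the disc about
     [Cexp w] avoids [0]. *)
  set (g := fun p => epsilon (inhabits w) (Q p)).
  assert (Hg : forall p, Cdist p (Cexp w) <= t ->
    Cexp (g p) = p /\ E / 2 <= exp (fst (g p)) /\ Rabs (snd (g p) - snd w) <= PI / 2).
  { intros p Hp.
    assert (Hp0 : p <> (0, 0)).
    { intros ->. rewrite Cdist_sym, <- Cmod_Cdist, Cmod_Cexp in Hp. fold E in Hp. lra. }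
    destruct (epsilon_spec (inhabits w) (Q p) (exists_log_near p (snd w) Hp0)) as [H1 H2].
    fold (g p) in H1, H2. split; [exact H1 |].
    apply Cexp_ball_bounds; [exact H2 |]. rewrite H1. fold E. lra. }
  (* In [Cexp_sep] both moduli are at least [E / 2], so squared distances shrink by [16 / E^2]. *)
  assert (Hsep : forall v v', E / 2 <= exp (fst v) -> E / 2 <= exp (fst v') ->
            Rabs (snd v - snd v') <= PI ->
            Cdist v v' <= 4 / E * Cdist (Cexp v) (Cexp v')).
  { intros v v' Hv Hv' Hd.
    pose proof (Cexp_sep v v' Hd) as H.
    pose proof (sqdist_nonneg v v').
    pose proof (Cdist_nonneg (Cexp v) (Cexp v')).
    apply Cdist_le_sqr.
    { apply Rmult_le_pos; [apply Rlt_le, Rdiv_lt_0_compat |]; lra. }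
    replace (4 / E * Cdist (Cexp v) (Cexp v') * (4 / E * Cdist (Cexp v) (Cexp v')))
      with (16 * sqdist (Cexp v) (Cexp v') / (E * E))
      by (rewrite <- Cdist_sqr; field; lra).
    apply Rmult_le_reg_r with (E * E); [nra |].
    replace (16 * sqdist (Cexp v) (Cexp v') / (E * E) * (E * E))
      with (16 * sqdist (Cexp v) (Cexp v')) by (field; lra).
    assert (E * E / 4 <= exp (fst v) * exp (fst v')) by nra.
    assert (E * E / 4 * sqdist v v' <= exp (fst v) * exp (fst v') * sqdist v v')
      by (apply Rmult_le_compat_r; assumption).
    lra. }
  exists g. split.
  - intros p Hp. destruct (Hg p Hp) as [H1 [H2 H3]]. pose proof PI_RGT_0.
    split; [| exact H1].
    eapply Rle_trans; [apply Hsep; [exact H2 | fold E; lra | lra] |].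
    rewrite H1. replace (4 * t / E) with (4 / E * t) by (field; lra).
    apply Rmult_le_compat_l; [| exact Hp]. apply Rlt_le, Rdiv_lt_0_compat; lra.
  - intros p q Hp Hq.
    destruct (Hg p Hp) as [H1 [H2 H3]]. destruct (Hg q Hq) as [H1' [H2' H3']].
    rewrite <- H1 at 2. rewrite <- H1' at 2. apply Hsep; trivial.
    replace (snd (g p) - snd (g q)) with ((snd (g p) - snd w) + - (snd (g q) - snd w)) by ring.
    eapply Rle_trans; [apply Rabs_triang |]. rewrite Rabs_Ropp. lra.
Qed.

(** Composes local logarithms along the orbit. There is no control on [t] and [K]; later contraction
    has to compensate for them. *)
Lemma orbit_inverse_branch (n : nat) (u : C) (r : R) :
  0 < r -> exists t K, 0 < t /\ 0 <= K /\ has_inverse_branch n (orbit u n) t u r K.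
Proof.
  intros Hr. induction n as [| n [t [K [Ht [HK IH]]]]].
  - exists r, 1. repeat split; try lra. exists (fun p => p). split.
    + intros p Hp. split; [exact Hp | reflexivity].
    + intros p q _ _. lra.
  - rewrite orbit_S. set (z := orbit u n) in *.
    pose proof (exp_pos (fst z)) as HE. set (E := exp (fst z)) in *.
    (* The first bound is the domain of the logarithm, the second makes its image radius [4 t' / E]
       at most [t]. *)
    set (t' := Rmin (E / 2) (t * E / 4)).
    assert (Ht1 : t' <= E / 2) by apply Rmin_l.
    assert (Ht2 : t' <= t * E / 4) by apply Rmin_r.
    assert (Ht' : 0 < t') by (apply Rmin_pos; nra).
    pose proof (Cexp_inverse_branch z t' Ht1) as H. fold E in H.
    exists t', (K * (4 / E)). repeat split; trivial.
    + apply Rmult_le_pos; [exact HK |]. apply Rlt_le, Rdiv_lt_0_compat; lra.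
    + apply (has_inverse_branch_comp 1 n _ _ _ _ _ _ _ _ _ IH H); [| exact HK].
      apply Rmult_le_reg_r with (E / 4); [lra |].
      replace (4 * t' / E * (E / 4)) with t' by (field; lra). lra.
Qed.

(** * Growth of discs along the real axis and contraction *)

Lemma Cexp_real (x : R) : Cexp (x, 0) = (exp x, 0).
Proof. unfold Cexp. simpl. rewrite cos_0, sin_0. f_equal; ring. Qed.

Lemma orbit_real_tail (z : C) (n k : nat) :
  snd (orbit z n) = 0 ->
  snd (orbit z (n + k)) = 0 /\ fst (orbit z n) + INR k <= fst (orbit z (n + k)).
Proof.
  intros H. induction k as [| k [IH1 IH2]]; [rewrite Nat.add_0_r; simpl; lra |].
  rewrite Nat.add_succ_r, orbit_S, S_INR.
  destruct (orbit z (n + k)) as [x y]. simpl in IH1, IH2. subst y.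
  rewrite Cexp_real. simpl. pose proof (exp_ge_1_plus x). lra.
Qed.

(** The bound [t <= 2] keeps the new radius within half the modulus [exp x], and [16 <= x] makes the
    factor [4 / exp x] at most 1, so [K] survives. *)
Lemma inverse_branch_real_step (n : nat) (a : C) (x t r K : R) :
  16 <= x -> t <= 2 -> 0 <= K ->
  has_inverse_branch n (x, 0) t a r K ->
  has_inverse_branch (S n) (exp x, 0) (t * exp x / 4) a r K.
Proof.
  intros Hx Ht HK H. pose proof (exp_ge_1_plus x) as HE.
  rewrite <- Cexp_real.
  pose proof (Cexp_inverse_branch (x, 0) (t * exp x / 4)) as H1. simpl fst in H1.
  specialize (H1 ltac:(nra)).
  apply has_inverse_branch_weaken with (t := t * exp x / 4) (K := K * (4 / exp x)); try lra.
  - apply (has_inverse_branch_comp 1 n _ _ _ _ _ _ _ _ _ H H1); [| exact HK].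
    right. field. lra.
  - rewrite <- (Rmult_1_r K) at 2. apply Rmult_le_compat_l; [exact HK |].
    apply Rmult_le_reg_r with (exp x); [lra |].
    replace (4 / exp x * exp x) with 4 by (field; lra). lra.
Qed.

(** Each step at least doubles the radius, capped at 2 so that the next step applies; a linear lower
    bound is enough to reach the cap. *)
Lemma inverse_branch_real_grow (n : nat) (a : C) (x t r K : R) (j : nat) :
  16 <= x -> 0 < t -> 0 <= K ->
  has_inverse_branch n (x, 0) t a r K ->
  exists n' x', 16 <= x' /\ has_inverse_branch n' (x', 0) (Rmin 2 (t * (1 + INR j))) a r K.
Proof.
  intros Hx Ht HK H. induction j as [| j [n' [x' [Hx' IH]]]].
  - exists n, x. split; [exact Hx |].
    apply has_inverse_branch_weaken with (1 := H); [| lra].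
    eapply Rle_trans; [apply Rmin_r | simpl; lra].
  - exists (S n'), (exp x'). pose proof (exp_ge_1_plus x'). split; [lra |].
    apply has_inverse_branch_weaken with
      (1 := inverse_branch_real_step _ _ _ _ _ _ Hx' (Rmin_l _ _) HK IH); [| lra].
    rewrite S_INR. pose proof (pos_INR j).
    assert (HA : t * (1 + (INR j + 1)) <= 2 * (t * (1 + INR j))) by nra.
    set (A := t * (1 + INR j)) in *. set (A' := t * (1 + (INR j + 1))) in *.
    assert (HA0 : 0 < A) by (unfold A; nra).
    unfold Rmin. destruct (Rle_dec 2 A'), (Rle_dec 2 A); nra.
Qed.

Lemma inverse_branch_real_large (n : nat) (a : C) (x t r K M : R) :
  16 <= x -> 0 < t -> 0 <= K ->
  has_inverse_branch n (x, 0) t a r K ->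
  exists n' x', M <= x' /\ 16 <= x' /\ has_inverse_branch n' (x', 0) (x' / 2) a r K.
Proof.
  intros Hx Ht HK H.
  destruct (INR_unbounded (2 / t)) as [j Hj].
  destruct (inverse_branch_real_grow n a x t r K j Hx Ht HK H) as [n0 [x0 [Hx0 H0]]].
  rewrite Rmin_left in H0.
  2: { apply Rle_trans with (t * (2 / t)); [right; field; lra |].
       apply Rmult_le_compat_l; lra. }
  (* Before each step the disc is cut back to radius 2; the step then yields a disc whose radius is
     again half its centre. *)
  assert (Hk : forall k, exists n' x', 16 + INR k <= x' /\
             has_inverse_branch n' (x', 0) (x' / 2) a r K).
  { induction k as [| k [n' [x' [Hx' IH]]]].
    - exists (S n0), (exp x0). pose proof (exp_ge_1_plus x0). simpl. split; [lra |].
      replace (exp x0 / 2) with (2 * exp x0 / 4) by field.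
      apply inverse_branch_real_step; trivial; lra.
    - exists (S n'), (exp x'). pose proof (exp_ge_1_plus x'). pose proof (pos_INR k).
      rewrite S_INR. split; [lra |].
      replace (exp x' / 2) with (2 * exp x' / 4) by field.
      apply inverse_branch_real_step; trivial; try lra.
      apply has_inverse_branch_weaken with (1 := IH); lra. }
  destruct (INR_unbounded M) as [k HkM]. destruct (Hk k) as [n' [x' [Hx' H']]].
  pose proof (pos_INR k). exists n', x'. repeat split; trivial; lra.
Qed.

(* Two logarithms take a disc around [b] first to a small set near [beta + 2 pi i k] and then
   near [x], provided [2 pi k] is about [exp x]. *)
Lemma inverse_branch_log_log (b : C) (t : R) :
  b <> (0, 0) -> t <= Cmod b / 2 ->
  exists M, forall x, M <= x -> 16 <= x ->
    has_inverse_branch 2 b t (x, 0) (x / 2) (32 / (Cmod b * exp x)).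
Proof.
  intros Hb Ht.
  destruct (exists_log_near b 0 Hb) as [[bx by_] [Hbeta _]].
  assert (Hmb : Cmod b = exp bx) by (rewrite <- Hbeta; apply Cmod_Cexp).
  pose proof (exp_pos bx) as HB. rewrite Hmb in *. set (B := exp bx) in *.
  set (L := Cmod (bx, by_)).
  (* Large enough that the error [L + PI] in [|beta|] stays below [exp x / 2]. *)
  exists (2 * (8 + L)). intros x HM Hx.
  pose proof (exp_ge_1_plus x) as HE. set (E := exp x) in *.
  pose proof PI_4. pose proof PI_RGT_0.
  destruct (exists_nearest_multiple E (2 * PI) ltac:(lra)) as [k Hk].
  apply Rabs_le_between in Hk.
  (* This logarithm of [b] is close to [i exp x], so its own logarithm has real part close to
     [x]. *)
  set (beta := (bx, by_ + IZR k * (2 * PI)) : C).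
  assert (Hbk : Cexp beta = b) by (unfold beta; rewrite Cexp_shift; exact Hbeta).
  assert (HL : 0 <= L) by apply sqrt_pos.
  assert (Hmod : E / 2 <= Cmod beta <= 2 * E).
  { assert (HbE : Cdist beta (0, E) <= L + PI).
    { eapply Rle_trans; [apply (Cdist_triangle _ (0, IZR k * (2 * PI))) |].
      apply Rplus_le_compat.
      - right. unfold L. rewrite Cmod_Cdist. unfold beta, Cdist. simpl. f_equal. f_equal; ring.
      - apply Cdist_le_sqr; [lra |]. unfold sqdist. simpl. nra. }
    assert (HEm : Cmod (0, E) = E).
    { unfold Cmod. simpl. rewrite Rmult_0_l, Rplus_0_l. apply sqrt_square. lra. }
    pose proof (Cdist_triangle beta (0, E) (0, 0)) as H1.
    pose proof (Cdist_triangle (0, E) beta (0, 0)) as H2.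
    rewrite <- !Cmod_Cdist in H1, H2. rewrite (Cdist_sym (0, E)) in H2. rewrite HEm in *. lra. }
  assert (Hbeta0 : beta <> (0, 0)).
  { intros E0. rewrite E0 in Hmod.
    assert (Cmod (0, 0) = 0) by (rewrite Cmod_Cdist; apply Cdist_refl). lra. }
  destruct (exists_log_near beta 0 Hbeta0) as [[gx gy] [Hgam Hgy]].
  simpl in Hgy. rewrite Rminus_0_r in Hgy. apply Rabs_le_between in Hgy.
  assert (HmG : Cmod beta = exp gx) by (rewrite <- Hgam; apply Cmod_Cexp).
  rewrite HmG in Hmod. set (G := exp gx) in *.
  assert (Hgx : x - 1 <= gx <= x + 1).
  { pose proof (exp_ge_1_plus 1) as He1. split; apply Rnot_lt_le; intros Hlt;
      apply exp_increasing in Hlt; fold G in Hlt.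
    - assert (E = exp (x - 1) * exp 1) by (unfold E; rewrite <- exp_plus; f_equal; ring).
      pose proof (exp_pos (x - 1)). nra.
    - rewrite exp_plus in Hlt. fold E in Hlt. nra. }
  assert (HG : 8 <= G) by lra.
  assert (H1 : has_inverse_branch 1 b t beta (4 * t / B) (4 / B)).
  { rewrite <- Hbk. apply (Cexp_inverse_branch beta). simpl. fold B. exact Ht. }
  assert (H2 : has_inverse_branch 1 beta 2 (x, 0) (x / 2) (4 / G)).
  { apply has_inverse_branch_recenter with (a := (gx, gy)) (r := 4 * 2 / G).
    - rewrite <- Hgam. apply (Cexp_inverse_branch (gx, gy)). simpl. fold G. lra.
    - assert (4 * 2 / G <= 1).
      { apply Rmult_le_reg_r with G; [lra |]. field_simplify; lra. }
      (* The real parts differ by at most 1 and the height is at most [PI]; adding the radius 1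
         still leaves less than [x / 2]. *)
      assert (Cdist (gx, gy) (x, 0) <= 6); [| lra].
      apply Cdist_le_sqr; [lra |]. unfold sqdist. simpl. nra. }
  apply has_inverse_branch_weaken with (t := t) (K := 4 / G * (4 / B)); [| lra |].
  - apply (has_inverse_branch_comp 1 1 _ _ _ _ _ _ _ _ _ H2 H1).
    + apply Rmult_le_reg_r with B; [lra |].
      replace (4 * t / B * B) with (4 * t) by (field; lra). lra.
    + apply Rlt_le, Rdiv_lt_0_compat; lra.
  (* The product [16 / (G B)] is at most [32 / (B E)] because [G >= E / 2]. *)
  - apply Rmult_le_reg_r with (B * E * G); [repeat apply Rmult_lt_0_compat; lra |].
    replace (4 / G * (4 / B) * (B * E * G)) with (16 * E) by (field; lra).
    replace (32 / (B * E) * (B * E * G)) with (32 * G) by (field; lra). lra.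
Qed.

Lemma contracting_inverse_branch (a b : C) (r t : R) :
  0 < r -> b <> (0, 0) -> t <= Cmod b / 2 ->
  exists n, (0 < n)%nat /\ has_inverse_branch n b t a r (1 / 2).
Proof.
  intros Hr Hb Ht.
  destruct (exists_real_in_orbit a (r / 2) ltac:(lra)) as [u [n0 [Hu Hn0]]].
  destruct (INR_unbounded (16 - fst (orbit u n0))) as [k Hk].
  destruct (orbit_real_tail u n0 k Hn0) as [Him Hre].
  destruct (orbit_inverse_branch (n0 + k) u (r / 2) ltac:(lra)) as [t1 [K [Ht1 [HK H1]]]].
  destruct (orbit u (n0 + k)) as [x1 y1]. simpl in Him, Hre. subst y1.
  apply has_inverse_branch_recenter with (a' := a) (r' := r) in H1;
    [| rewrite Cdist_sym in Hu; rewrite Cdist_sym; lra].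
  destruct (inverse_branch_log_log b t Hb Ht) as [M HM].
  pose proof (Cmod_pos b Hb) as HB.
  (* Since [K] is already fixed, [x2] can be taken so large that [32 K / (|b| exp x2) <= 1 / 2]. *)
  destruct (inverse_branch_real_large (n0 + k) a x1 t1 r K (Rmax M (64 * K / Cmod b)))
    as [n2 [x2 [HM2 [Hx2 H2]]]]; trivial; [lra |].
  specialize (HM x2 (Rle_trans _ _ _ (Rmax_l _ _) HM2) Hx2).
  assert (HK2 : 64 * K / Cmod b <= x2) by (eapply Rle_trans; [apply Rmax_r | exact HM2]).
  exists (2 + n2)%nat. split; [lia |].
  apply has_inverse_branch_weaken with (t := t) (K := K * (32 / (Cmod b * exp x2))); [| lra |].
  - apply (has_inverse_branch_comp 2 n2 _ _ _ _ _ _ _ _ _ H2 HM); lra.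
  - pose proof (exp_ge_1_plus x2).
    set (B := Cmod b) in *. set (E := exp x2) in *.
    assert (HKB : 64 * K <= x2 * B).
    { apply (Rmult_le_compat_r B) in HK2; [| lra].
      replace (64 * K / B * B) with (64 * K) in HK2 by (field; lra). exact HK2. }
    apply Rmult_le_reg_r with (B * E); [nra |].
    replace (K * (32 / (B * E)) * (B * E)) with (32 * K) by (field; lra). nra.
Qed.

(** * Limits along infinite chains of contracting branches *)

Lemma pow_half_small (A eps : R) : 0 < eps -> exists m, A * (1 / 2) ^ m < eps.
Proof.
  intros He. destruct (pow_lt_1_zero (1 / 2)) with (y := eps / (Rabs A + 1)) as [m Hm].
  - rewrite Rabs_right; lra.
  - pose proof (Rabs_pos A). apply Rdiv_lt_0_compat; lra.
  - exists m. specialize (Hm m (le_n m)).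
    rewrite Rabs_right in Hm by (apply Rle_ge, pow_le; lra).
    pose proof (Rabs_pos A). pose proof (Rle_abs A).
    assert (Hp : 0 < (1 / 2) ^ m) by (apply pow_lt; lra).
    apply (Rmult_lt_compat_r (Rabs A + 1)) in Hm; [| lra].
    replace (eps / (Rabs A + 1) * (Rabs A + 1)) with eps in Hm by (field; lra). nra.
Qed.

Lemma le_of_forall_pow_half (x A B : R) : (forall m, x <= A + B * (1 / 2) ^ m) -> x <= A.
Proof.
  intros H. apply Rnot_lt_le. intros Hlt.
  destruct (pow_half_small B (x - A) ltac:(lra)) as [m Hm]. specialize (H m). lra.
Qed.

Lemma geometric_Un_cv (u : nat -> R) :
  (forall m k, Rabs (u m - u (m + k)%nat) <= 2 * (1 / 2) ^ m) -> exists l, Un_cv u l.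
Proof.
  intros H. assert (Hc : Cauchy_crit u).
  { intros eps He. destruct (pow_half_small 4 eps He) as [m Hm]. exists m.
    intros i j Hi Hj. unfold Rdist.
    replace (u i - u j) with (- (u m - u (m + (i - m))%nat) + (u m - u (m + (j - m))%nat)).
    - eapply Rle_lt_trans; [apply Rabs_triang |]. rewrite Rabs_Ropp.
      pose proof (H m (i - m)%nat). pose proof (H m (j - m)%nat). lra.
    - replace (m + (i - m))%nat with i by lia. replace (m + (j - m))%nat with j by lia. ring. }
  destruct (Rcomplete.R_complete u Hc) as [l Hl]. now exists l.
Qed.

Lemma Cdist_le_Rabs (z w : C) : Cdist z w <= Rabs (fst z - fst w) + Rabs (snd z - snd w).
Proof.
  pose proof (Rabs_pos (fst z - fst w)). pose proof (Rabs_pos (snd z - snd w)).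
  apply Cdist_le_sqr; [lra |]. unfold sqdist.
  pose proof (Rsqr_abs (fst z - fst w)). pose proof (Rsqr_abs (snd z - snd w)).
  unfold Rsqr in *. nra.
Qed.

Lemma geometric_limit (p : nat -> C) :
  (forall m, Cdist (p m) (p (S m)) <= (1 / 2) ^ m) ->
  exists l, forall m, Cdist (p m) l <= 2 * (1 / 2) ^ m.
Proof.
  intros H.
  assert (Hk : forall k m, Cdist (p m) (p (m + k)%nat) <= 2 * (1 / 2) ^ m).
  { induction k as [| k IH]; intros m.
    - rewrite Nat.add_0_r, Cdist_refl. pose proof (pow_lt (1 / 2) m). lra.
    - replace (m + S k)%nat with (S m + k)%nat by lia.
      pose proof (Cdist_triangle (p m) (p (S m)) (p (S m + k)%nat)).
      pose proof (IH (S m)) as IHm. pose proof (H m). simpl pow in IHm. lra. }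
  destruct (geometric_Un_cv (fun m => fst (p m))) as [x Hx].
  { intros m k. eapply Rle_trans; [apply Rabs_fst_le_Cdist | apply Hk]. }
  destruct (geometric_Un_cv (fun m => snd (p m))) as [y Hy].
  { intros m k. eapply Rle_trans; [apply Rabs_snd_le_Cdist | apply Hk]. }
  exists (x, y). intros m. apply Rnot_lt_le. intros Hlt.
  set (gap := Cdist (p m) (x, y) - 2 * (1 / 2) ^ m).
  assert (Hgap : 0 < gap / 2) by (unfold gap; lra).
  destruct (Hx _ Hgap) as [N1 HN1]. destruct (Hy _ Hgap) as [N2 HN2].
  specialize (HN1 (m + (N1 + N2))%nat ltac:(lia)).
  specialize (HN2 (m + (N1 + N2))%nat ltac:(lia)).
  unfold Rdist in *.
  pose proof (Hk (N1 + N2)%nat m).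
  pose proof (Cdist_triangle (p m) (p (m + (N1 + N2))%nat) (x, y)).
  pose proof (Cdist_le_Rabs (p (m + (N1 + N2))%nat) (x, y)) as Hr. simpl in Hr.
  unfold gap in *. lra.
Qed.

(** The composite of [g n], ..., [g (n + m - 1)] applied to the centre [c (n + m)]. *)
Fixpoint pullback (c : nat -> C) (g : nat -> C -> C) (n m : nat) : C :=
  match m with
  | O => c n
  | S m => g n (pullback c g (S n) m)
  end.

(** Pullbacks of depths [m] and [m + 1] differ by at most [(1 / 2)^m], so they converge, and the
    Lipschitz bound carries the recursion to the limits. As [g n] inverts an iterate, one orbit
    passes through all [z n]. *)
Lemma inverse_branch_chain (c : nat -> C) (t : nat -> R) (N : nat -> nat) (g : nat -> C -> C) :
  (forall n, 0 <= t n <= 1) ->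
  (forall n, inverse_branch (N n) (c (S n)) (t (S n)) (c n) (t n) (1 / 2) (g n)) ->
  exists z : nat -> C, forall n, Cdist (z n) (c n) <= t n /\ z n = g n (z (S n)).
Proof.
  intros Ht Hg.
  assert (Hin : forall m n, Cdist (pullback c g n m) (c n) <= t n).
  { induction m as [| m IH]; intros n; simpl.
    - rewrite Cdist_refl. apply Ht.
    - apply (Hg n). apply IH. }
  assert (Hcau : forall m n, Cdist (pullback c g n m) (pullback c g n (S m)) <= (1 / 2) ^ m).
  { induction m as [| m IH]; intros n.
    - rewrite Cdist_sym. simpl pow. apply Rle_trans with (t n); [apply Hin | apply Ht].
    - eapply Rle_trans; [exact (proj2 (Hg n) _ _ (Hin m (S n)) (Hin (S m) (S n))) |].
      specialize (IH (S n)). simpl pow. lra. }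
  assert (Hlim : forall n, exists l, forall m, Cdist (pullback c g n m) l <= 2 * (1 / 2) ^ m)
    by (intros n; apply geometric_limit; intros m; apply Hcau).
  set (z := fun n => proj1_sig (constructive_indefinite_description _ (Hlim n))).
  assert (Hz : forall n m, Cdist (pullback c g n m) (z n) <= 2 * (1 / 2) ^ m)
    by (intros n; exact (proj2_sig (constructive_indefinite_description _ (Hlim n)))).
  assert (Hzin : forall n, Cdist (z n) (c n) <= t n).
  { intros n. apply le_of_forall_pow_half with (B := 2). intros m.
    pose proof (Cdist_triangle (z n) (pullback c g n m) (c n)).
    pose proof (Hz n m) as Hnm. rewrite Cdist_sym in Hnm. pose proof (Hin m n). lra. }
  exists z. intros n. split; [apply Hzin |].
  apply Cdist_eq_0. apply le_of_forall_pow_half with (B := 2). intros m.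
  pose proof (Cdist_triangle (z n) (pullback c g n (S m)) (g n (z (S n)))).
  pose proof (Hz n (S m)) as H1. rewrite Cdist_sym in H1.
  pose proof (Hz (S n) m) as H2.
  assert (H3 : Cdist (pullback c g n (S m)) (g n (z (S n)))
                 <= 1 / 2 * Cdist (pullback c g (S n) m) (z (S n)))
    by (apply (Hg n); [apply Hin | apply Hzin]).
  simpl pow in H1. lra.
Qed.

(** * The three density statements *)

Lemma exists_nonzero_near (w : C) (eps : R) :
  0 < eps -> exists b, b <> (0, 0) /\ Cdist b w <= eps.
Proof.
  intros He. destruct (classic (w = (0, 0))) as [-> | Hw].
  - exists (eps, 0). split; [intros E; injection E; lra |].
    apply Cdist_le_sqr; [lra |]. unfold sqdist. simpl. lra.
  - exists w. rewrite Cdist_refl. split; [exact Hw | lra].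
Qed.

Lemma periodic_points_dense : dense_in_C periodic_point.
Proof.
  intros w eps He.
  destruct (exists_nonzero_near w (eps / 2) ltac:(lra)) as [b [Hb Hbw]].
  pose proof (Cmod_pos b Hb) as HB.
  set (t := Rmin (Cmod b / 2) (Rmin 1 (eps / 4))).
  assert (Ht1 : t <= Cmod b / 2) by apply Rmin_l.
  assert (Ht2 : t <= 1) by (eapply Rle_trans; [apply Rmin_r | apply Rmin_l]).
  assert (Ht3 : t <= eps / 4) by (eapply Rle_trans; [apply Rmin_r | apply Rmin_r]).
  assert (Ht0 : 0 < t) by (repeat apply Rmin_pos; lra).
  destruct (contracting_inverse_branch b b t t Ht0 Hb Ht1) as [N [HN [g Hg]]].
  (* A constant chain plays the part of the contraction principle: the points [z n] turn out to
     coincide in a fixed point of [g]. *)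
  destruct (inverse_branch_chain (fun _ => b) (fun _ => t) (fun _ => N) (fun _ => g))
    as [z Hz]; [intros; lra | intros; exact Hg |].
  assert (Hclose : forall m n, Cdist (z n) (z (S n)) <= 0 + 2 * (1 / 2) ^ m).
  { induction m as [| m IH]; intros n.
    - pose proof (Cdist_triangle (z n) b (z (S n))) as H. rewrite (Cdist_sym b) in H.
      pose proof (proj1 (Hz n)). pose proof (proj1 (Hz (S n))). simpl. lra.
    - replace (Cdist (z n) (z (S n))) with (Cdist (g (z (S n))) (g (z (S (S n)))))
        by (f_equal; symmetry; apply Hz).
      eapply Rle_trans; [apply (proj2 Hg); apply Hz |].
      specialize (IH (S n)). simpl pow. lra. }
  assert (Hfix : z 0%nat = z 1%nat).
  { apply Cdist_eq_0. apply le_of_forall_pow_half with (B := 2). intros m. apply Hclose. }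
  destruct (Hz 0%nat) as [Hz0 Hz1]. rewrite <- Hfix in Hz1.
  assert (Hper : orbit (z 0%nat) N = z 0%nat).
  { rewrite Hz1 at 1. apply (proj1 Hg). exact Hz0. }
  exists (z 0%nat). split.
  - exists N. split; [exact HN |]. intros n. rewrite orbit_plus, Hper. reflexivity.
  - pose proof (Cdist_triangle (z 0%nat) b w). lra.
Qed.

Lemma escaping_points_dense : dense_in_C escapes.
Proof.
  intros w eps He.
  assert (H1 : Cmod (1, 0) = 1).
  { unfold Cmod. simpl. rewrite Rmult_0_l, Rplus_0_r. apply sqrt_square. lra. }
  (* Radius [0]: a single preimage of [1] is wanted, whose orbit then increases to infinity along
     the reals. *)
  destruct (contracting_inverse_branch w (1, 0) (eps / 2) 0) as [N [_ [g Hg]]];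
    [lra | intros E; injection E; lra | rewrite H1; lra |].
  destruct (proj1 Hg (1, 0)) as [Hd Ho]; [rewrite Cdist_refl; lra |].
  exists (g (1, 0)). split; [| lra].
  intros M. destruct (INR_unbounded M) as [k Hk]. exists (N + k)%nat. intros n Hn.
  replace n with (N + (n - N))%nat by lia.
  destruct (orbit_real_tail (g (1, 0)) N (n - N)) as [_ H2].
  { rewrite Ho. reflexivity. }
  rewrite Ho in H2. simpl in H2.
  pose proof (Rabs_fst_le_Cdist (orbit (g (1, 0)) (N + (n - N))) (0, 0)) as H3.
  rewrite <- Cmod_Cdist in H3. simpl in H3. rewrite Rminus_0_r in H3.
  pose proof (Rle_abs (fst (orbit (g (1, 0)) (N + (n - N))))).
  pose proof (le_INR k (n - N) ltac:(lia)). lra.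
Qed.

(** Encoding rationals by three naturals lets Cantor pairing enumerate them. *)
Lemma exists_rational_near (x eps : R) :
  0 < eps -> exists i j l, Rabs ((INR i - INR j) / (INR l + 1) - x) < eps.
Proof.
  intros He. destruct (INR_unbounded (1 / eps)) as [l Hl].
  pose proof (pos_INR l).
  assert (Hinv : / (INR l + 1) < eps).
  { rewrite <- (Rinv_inv eps). apply Rinv_lt_contravar; [| lra].
    apply Rmult_lt_0_compat; [now apply Rinv_0_lt_compat | lra]. }
  assert (Hp : 0 < / (INR l + 1)) by (apply Rinv_0_lt_compat; lra).
  destruct (exists_nearest_multiple x (/ (INR l + 1)) Hp) as [k Hk].
  exists (Z.to_nat k), (Z.to_nat (- k)), l.
  replace (INR (Z.to_nat k) - INR (Z.to_nat (- k))) with (IZR k).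
  - rewrite Rabs_minus_sym. unfold Rdiv. lra.
  - rewrite !INR_IZR_INZ, <- minus_IZR. f_equal. lia.
Qed.

Lemma exists_dense_sequence :
  exists c : nat -> C, (forall n, c n <> (0, 0)) /\
    forall w eps M, 0 < eps -> exists n, (M <= n)%nat /\ Cdist (c n) w < eps.
Proof.
  set (rat := fun n => let (i, n') := of_nat n in let (j, l) := of_nat n' in
                       (INR i - INR j) / (INR l + 1)).
  assert (Hrat : forall x eps, 0 < eps -> exists n, Rabs (rat n - x) < eps).
  { intros x eps He. destruct (exists_rational_near x eps He) as [i [j [l H]]].
    exists (to_nat (i, to_nat (j, l))). unfold rat. rewrite !cancel_of_to. exact H. }
  (* The second component of the pairing repeats each value at arbitrarily large indices. *)
  set (c0 := fun n => let (k, _) := of_nat n in let (i, j) := of_nat k in (rat i, rat j) : C).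
  (* Centres of inverse branches must differ from [0], so [0] is replaced by [1]. *)
  set (c := fun n => if excluded_middle_informative (c0 n = (0, 0)) then (1, 0) else c0 n).
  exists c. split.
  - intros n. unfold c. destruct (excluded_middle_informative (c0 n = (0, 0))); [| assumption].
    intros E. injection E. lra.
  - intros w eps M He.
    destruct (exists_nonzero_near w (eps / 2) ltac:(lra)) as [b [Hb Hbw]].
    pose proof (Cmod_pos b Hb) as HB.
    (* The bound [|b| / 4] keeps [c0 n] away from [0], so that [c n] equals it. *)
    set (d := Rmin (Cmod b / 4) (eps / 4)).
    assert (Hd : 0 < d) by (apply Rmin_pos; lra).
    assert (Hd1 : d <= Cmod b / 4) by apply Rmin_l.
    assert (Hd2 : d <= eps / 4) by apply Rmin_r.
    destruct (Hrat (fst b) d Hd) as [i Hi]. destruct (Hrat (snd b) d Hd) as [j Hj].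
    set (n := to_nat (to_nat (i, j), M)).
    assert (Hc0 : c0 n = (rat i, rat j)) by (unfold c0, n; now rewrite !cancel_of_to).
    assert (Hcb : Cdist (c0 n) b < 2 * d).
    { rewrite Hc0. eapply Rle_lt_trans; [apply Cdist_le_Rabs |]. simpl. lra. }
    exists n. split.
    + pose proof (to_nat_non_decreasing (to_nat (i, j)) M). unfold n. lia.
    + unfold c. destruct (excluded_middle_informative (c0 n = (0, 0))) as [E | _].
      * rewrite E, Cdist_sym, <- Cmod_Cdist in Hcb. lra.
      * pose proof (Cdist_triangle (c0 n) b w). lra.
Qed.

Lemma dense_orbits_dense : dense_in_C dense_orbit.
Proof.
  intros w eps He.
  destruct exists_dense_sequence as [d [Hd0 Hd]].
  destruct (exists_nonzero_near w (eps / 2) ltac:(lra)) as [b [Hb Hbw]].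
  (* The chain starts near [w] and then follows the dense sequence, with indices shifted by one. *)
  set (c := fun n => match n with O => b | S n => d n end).
  (* The radii tend to [0], so the points [z n] inherit density from the centres, which recur near
     every point at large indices. *)
  set (s := fun n => match n with O => eps / 4 | S n => / (INR n + 1) end).
  set (t := fun n => Rmin (Cmod (c n) / 2) (Rmin 1 (s n))).
  assert (Hc : forall n, c n <> (0, 0)) by (intros [| n]; [exact Hb | apply Hd0]).
  assert (Hs : forall n, 0 < s n).
  { intros [| n]; simpl; [lra |]. apply Rinv_0_lt_compat. pose proof (pos_INR n). lra. }
  assert (Ht0 : forall n, 0 < t n).
  { intros n. pose proof (Cmod_pos _ (Hc n)). specialize (Hs n).
    repeat apply Rmin_pos; lra. }
  assert (Ht1 : forall n, t n <= Cmod (c n) / 2) by (intros n; apply Rmin_l).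
  assert (Ht2 : forall n, t n <= 1)
    by (intros n; eapply Rle_trans; [apply Rmin_r | apply Rmin_l]).
  assert (Ht3 : forall n, t n <= s n)
    by (intros n; eapply Rle_trans; [apply Rmin_r | apply Rmin_r]).
  assert (Hbr : forall n, exists Ng : nat * (C -> C),
            inverse_branch (fst Ng) (c (S n)) (t (S n)) (c n) (t n) (1 / 2) (snd Ng)).
  { intros n.
    destruct (contracting_inverse_branch (c n) (c (S n)) (t n) (t (S n))) as [N [_ [g Hg]]];
      auto. now exists (N, g). }
  set (Ng := fun n => proj1_sig (constructive_indefinite_description _ (Hbr n))).
  assert (HNg : forall n, inverse_branch (fst (Ng n)) (c (S n)) (t (S n)) (c n) (t n) (1 / 2)
                            (snd (Ng n)))
    by (intros n; exact (proj2_sig (constructive_indefinite_description _ (Hbr n)))).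
  destruct (inverse_branch_chain c t (fun n => fst (Ng n)) (fun n => snd (Ng n)))
    as [z Hz]; [intros n; pose proof (Ht0 n); pose proof (Ht2 n); lra | exact HNg |].
  assert (Horb : forall n, exists k, orbit (z 0%nat) k = z n).
  { induction n as [| n [k IH]]; [now exists 0%nat |].
    exists (fst (Ng n) + k)%nat. rewrite orbit_plus, IH, (proj2 (Hz n)).
    apply (HNg n). apply Hz. }
  exists (z 0%nat). split.
  - intros v e Hepos. destruct (INR_unbounded (2 / e)) as [M HM].
    destruct (Hd v (e / 2) M ltac:(lra)) as [n [Hn Hnv]].
    destruct (Horb (S n)) as [k Hk]. exists (z (S n)). split; [now exists k |].
    pose proof (proj1 (Hz (S n))) as Hzn. pose proof (Ht3 (S n)) as Hsn.
    simpl c in Hzn. simpl s in Hsn.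
    assert (Hinv : / (INR n + 1) < e / 2).
    { rewrite <- (Rinv_inv (e / 2)). apply le_INR in Hn.
      replace (/ (e / 2)) with (2 / e) by (field; lra).
      assert (0 < 2 / e) by (apply Rdiv_lt_0_compat; lra).
      apply Rinv_lt_contravar; [apply Rmult_lt_0_compat |]; lra. }
    pose proof (Cdist_triangle (z (S n)) (d n) v). lra.
  - pose proof (proj1 (Hz 0%nat)) as Hz0. pose proof (Ht3 0%nat) as Hs0.
    simpl c in Hz0. simpl s in Hs0.
    pose proof (Cdist_triangle (z 0%nat) b w). lra.
Qed.

Theorem mainTheorem1 :
  dense_in_C escapes /\ dense_in_C dense_orbit /\ dense_in_C periodic_point.
Proof.
  exact (conj escaping_points_dense (conj dense_orbits_dense periodic_points_dense)).
Qed.
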